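(* For every $\Theta\subset\Pi$ and all $C,D\in W_\Theta\backslash W$, $$P_{CD}=\sum_{v\in W_\Theta}(-q)^{\ell(v)}\,P_{w_\Theta w^C,\; v w_\Theta w^D},$$ where the $P_{CD}$ are the Whittaker Kazhdan--Lusztig polynomials for $\Theta$ and the polynomials $P_{x,y}$, $x,y\in W$, on the right-hand side are the Kazhdan--Lusztig polynomials, i.e. the Whittaker Kazhdan--Lusztig polynomials for the empty subset of $\Pi$.
   Context: Let $W$ be the Weyl group of a reduced root system with simple roots $\Pi$, simple reflections $s_\alpha$, length $\ell$; for $\Theta\subset\Pi$ let $W_\Theta\subset W$ be the subgroup generated by $s_\alpha$, $\alpha\in\Theta$, and $w_\Theta$ its longest element. For a coset $C\in W_\Theta\backslash W$, $w^C$ is its unique longest element (so $w_\Theta w^C$ is its shortest element); $C\le D$ means $w^C\le w^D$ in the Bruhat order. $\mathcal H_\Theta$ is the free $\mathbb Z[q,q^{-1}]$-module with basis $\{\delta_C\}_{C\in W_\Theta\backslash W}$, and for $\alpha\in\Pi$, $T_\alpha$ is its $\mathbb Z[q,q^{-1}]$-linear endomorphism with $T_\alpha(\delta_C)=0$ if $Cs_\alpha=C$; $q\delta_C+\delta_{Cs_\alpha}$ if $Cs_\alpha>C$; $q^{-1}\delta_C+\delta_{Cs_\alpha}$ if $Cs_\alpha<C$. There is a unique function $\varphi_\Theta:W_\Theta\backslash W\to\mathcal H_\Theta$ such that (i) $\varphi_\Theta(C)=\delta_C+\sum_{D<C}P_{CD}\delta_D$ with $P_{CD}\in q\mathbb Z[q]$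 for all $C$, and (ii) whenever $\alpha\in\Pi$ and $Cs_\alpha<C$, $T_\alpha(\varphi_\Theta(Cs_\alpha))=\sum_{D\le C}c_D\varphi_\Theta(D)$ for some $c_D\in\mathbb Z$. The $P_{CD}$ are the Whittaker Kazhdan--Lusztig polynomials for $\Theta$, with the conventions $P_{CC}=1$ and $P_{CD}=0$ if $D\not\le C$. For $\Theta=\emptyset$, cosets are elements of $W$ and the order is the Bruhat order. *)

(* Defs.v *)
From HB Require Import structures.
From mathcomp Require Import all_boot all_order all_algebra all_fingroup.
From mathcomp Require Import boolp.

Set Implicit Arguments.
Unset Strict Implicit.
Unset Printing Implicit Defensive.

Import Order.TTheory GRing.Theory Num.Theory.
Local Open Scope group_scope.
Local Open Scope ring_scope.

(* Z[q, q^-1], as the subring of the field of fractions Q(q) of Z[q] formed by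
   the f such that q^n f is in Z[q] for some n *)
Definition is_laurent : pred {fraction {poly int}} :=
  fun f => `[< exists (n : nat) (p : {poly int}),
               f * tofrac ('X^n) = tofrac p >].

Lemma is_laurent_subring : subring_closed is_laurent.
Proof.
split.
- by apply/asboolP; exists 0%N, 1; rewrite expr0 mul1r.
- move=> f g /asboolP[m [p fE]] /asboolP[n [r gE]]; apply/asboolP.
  exists (m + n)%N, (p * 'X^n - r * 'X^m).
  by rewrite exprD tofracB !tofracM -fE -gE mulrBl mulrA
    [tofrac 'X^m * _]mulrC mulrA.
- move=> f g /asboolP[m [p fE]] /asboolP[n [r gE]]; apply/asboolP.
  by exists (m + n)%N, (p * r); rewrite exprD !tofracM -fE -gE mulrACA.
Qed.

HB.instance Definition _ :=
  GRing.isSubringClosed.Build {fraction {poly int}} is_laurent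
    is_laurent_subring.

Record laurent := Laurent {
  laurent_val : {fraction {poly int}};
  laurent_valP : laurent_val \in is_laurent }.

HB.instance Definition _ := [isSub for laurent_val].
HB.instance Definition _ := [Choice of laurent by <:].
HB.instance Definition _ := [SubChoice_isSubComNzRing of laurent by <:].

Lemma is_laurent_poly (p : {poly int}) : tofrac p \in is_laurent.
Proof. by apply/asboolP; exists 0%N, p; rewrite expr0 mulr1. Qed.

Lemma is_laurent_invX : (tofrac 'X)^-1 \in is_laurent.
Proof.
apply/asboolP; exists 1%N, 1; rewrite expr1 mulVf ?rmorph1 //.
by rewrite tofrac_eq0 polyX_eq0.
Qed.

Definition laurent_poly (p : {poly int}) : laurent :=
  Laurent (is_laurent_poly p).
Definition laurent_q : laurent := laurent_poly 'X.
Definition laurent_qV : laurent := Laurent is_laurent_invX.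

Lemma laurent_qVK : laurent_q * laurent_qV = 1.
Proof. by apply: val_inj; rewrite /= mulfV // tofrac_eq0 polyX_eq0. Qed.

Record reduced_root_system (F : numFieldType) (V : vectType F) :=
  ReducedRootSystem {
    roots : seq V;
    (* only the values of [coroot] at roots are relevant; they are determined
       by [roots] *)
    coroot : V -> {scalar V};
    roots_span : <<roots>>%VS = fullv;
    roots_neq0 : 0 \notin roots;
    coroot_root : forall a, a \in roots -> coroot a a = 2;
    roots_refl : forall a b,
      a \in roots -> b \in roots -> b - coroot a b *: a \in roots;
    coroot_int : forall a b,
      a \in roots -> b \in roots -> exists n : int, coroot a b = n%:~R;
    roots_reduced : forall a (c : F),
      a \in roots -> c *: a \in roots -> c = 1 \/ c = -1 }.

Section Whittaker.

Variables (F : numFieldType) (V : vectType F) (Phi : reduced_root_system V).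

Definition root_of := seq_sub (roots Phi).
HB.instance Definition _ := Finite.on root_of.

Implicit Types (a b : root_of).

Definition refl_root a b : root_of := SeqSub (roots_refl (valP a) (valP b)).

Lemma refl_rootK a : involutive (refl_root a).
Proof.
move=> b; apply: val_inj => /=.
rewrite linearB scalarZ (coroot_root (ssvalP a)).
set c := coroot Phi _ _.
by rewrite mulr_natr mulr2n opprD addrA subrr sub0r scaleNr opprK subrK.
Qed.

Definition refl_perm a : {perm root_of} := perm (inv_inj (@refl_rootK a)).

(* As the roots span V, the Weyl group acts faithfully on them: it is identified
   with the group of permutations of the roots generated by the reflections.
   The product of permutations is [(u * v) a = v (u a)], so that the group acts
   on the right; inversion identifies it with the group acting on the left, and
   fixes the reflections. *)
Definition weyl_group := <<[set refl_perm a | a : root_of]>>%G.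

Local Notation W := (subg_of weyl_group).

Lemma refl_perm_weyl a : refl_perm a \in weyl_group.
Proof. exact/mem_gen/imset_f. Qed.

Definition refl a : W := Subg (refl_perm_weyl a).

Definition simple_roots (Pi : {set root_of}) : Prop :=
  basis_of fullv [seq val a | a <- enum Pi] /\
  forall b, exists c : root_of -> nat,
    val b = \sum_(a in Pi) (c a)%:R *: val a \/
    val b = - \sum_(a in Pi) (c a)%:R *: val a.

Variable Pi : {set root_of}.

Definition parabolic (Theta : {set root_of}) : {group W} :=
  <<[set refl a | a in Theta]>>%G.

Lemma length_ex (w : W) :
  exists n, (w \in parabolic Pi) ==> (w \in [set refl a | a in Pi] ^+ n)%g.
Proof.
case: (boolP (w \in parabolic Pi)) => [/gen_prodgP[n [c cS ->]]|_];
  last by exists 0%N.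
exists n; apply/implyP => _.
elim: n c cS => [|n IHn] c cS; first by rewrite big_ord0 expg0 set11.
by rewrite big_ord_recl expgS mem_mulg ?cS ?IHn.
Qed.

(* The value outside [parabolic Pi] is 0, but [parabolic Pi] is the whole Weyl
   group when Pi is a set of simple roots *)
Definition length (w : W) : nat := ex_minn (length_ex w).

Definition bruhat : rel W :=
  connect (fun x y =>
    [exists a : root_of, y == (x * refl a)%g] && (length x < length y)%N).

(* A longest element of A; it is unique if A is a coset of a parabolic subgroup *)
Definition longest (A : {set W}) : W := [arg max_(w > repr A in A) length w].

Section Cosets.

Variable Theta : {set root_of}.

Definition cosets := {C : {set W} | C \in rcosets (parabolic Theta) [set: W]}.
HB.instance Definition _ := SubFinite.on cosets.

Lemma coset_cls_subproof (w : W) :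
  (parabolic Theta :* w)%g \in rcosets (parabolic Theta) [set: W].
Proof. by rewrite mem_rcosets mulSGid ?subsetT ?inE. Qed.

Definition coset_cls (w : W) : cosets :=
  Sub (parabolic Theta :* w)%g (coset_cls_subproof w).

Lemma coset_mul_subproof (C : cosets) (w : W) :
  (val C :* w)%g \in rcosets (parabolic Theta) [set: W].
Proof.
by have /rcosetsP[x _ ->] := valP C; rewrite -rcosetM coset_cls_subproof.
Qed.

Definition coset_mul (C : cosets) (w : W) : cosets :=
  Sub (val C :* w)%g (coset_mul_subproof C w).

Definition coset_le (C D : cosets) : bool :=
  bruhat (longest (val C)) (longest (val D)).

Definition coset_lt (C D : cosets) : bool := (C != D) && coset_le C D.

Definition hecke_module := {ffun cosets -> laurent^o}.

Definition delta (C : cosets) : hecke_module := [ffun D => (C == D)%:R].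

(* When C s_a <> C, the cosets C and C s_a are comparable, so that the last case
   is C s_a < C *)
Definition hecke_T_delta a (C : cosets) : hecke_module :=
  let Cs := coset_mul C (refl a) in
  if Cs == C then 0
  else if coset_lt C Cs then laurent_q *: delta C + delta Cs
  else laurent_qV *: delta C + delta Cs.

Definition hecke_T a (h : hecke_module) : hecke_module :=
  \sum_(C : cosets) (h C : laurent) *: hecke_T_delta a C.

Definition whittaker_phi (P : cosets -> cosets -> {poly int}) (C : cosets) :
    hecke_module :=
  delta C + \sum_(D | coset_lt D C) laurent_poly (P C D) *: delta D.

(* P is the family of Whittaker Kazhdan-Lusztig polynomials for Theta, that is,
   [whittaker_phi P] is the unique function with the two defining properties,
   and P follows the conventions for the pairs (C, D) such that D < C fails *)
Record whittaker_kl (P : cosets -> cosets -> {poly int}) : Prop := WhittakerKL {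
  wkl_diag : forall C, P C C = 1;
  wkl_nle : forall C D, ~~ coset_le D C -> P C D = 0;
  wkl_lt : forall C D, coset_lt D C -> exists p : {poly int}, P C D = 'X * p;
  wkl_T : forall a C, a \in Pi ->
    coset_lt (coset_mul C (refl a)) C ->
    exists c : cosets -> int,
      hecke_T a (whittaker_phi P (coset_mul C (refl a))) =
      \sum_(D | coset_le D C) (c D)%:~R *: whittaker_phi P D }.

End Cosets.

End Whittaker.

(* Main.v *)
(* Let zeta : H -> H_Theta be the linear map sending delta_(z y), for z in W_Theta
   and y of minimal length in its coset C, to (-q)^l(z) delta_C; it commutes with
   the operators T_a.  The sum in the theorem is the coefficient at D of
   zeta(phi(y)), phi being the family for the empty set and y = w_Theta w^C, so
   it is enough to prove, for w = z y as above, that zeta(phi(w)) is phi_Theta(C)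
   if z = 1 and is 0 otherwise.  This is by induction on l(w).  Write s for a
   right descent of y if y <> 1, of z otherwise.  Applying zeta to property (ii)
   of phi for ws < w expresses the difference between zeta(phi(w)) and its
   expected value as an integral combination of the phi_Theta(D); the constant
   terms of the coefficients of the difference vanish, while the matrix of the
   phi_Theta(D) is the identity modulo q, so the combination is trivial.

   The facts on Weyl groups come from the identity of the length with the number
   of inversions. *)

Require Import Defs.
From HB Require Import structures.
From mathcomp Require Import all_boot all_order all_algebra all_fingroup.

Set Implicit Arguments.
Unset Strict Implicit.
Unset Printing Implicit Defensive.

Import Order.TTheory GRing.Theory Num.Theory.
Local Open Scope group_scope.
Local Open Scope ring_scope.

(** * Roots, inversions and length *)

Section Roots.

Variables (F : numFieldType) (V : vectType F) (Phi : reduced_root_system V).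
Variable Pi : {set root_of Phi}.
Hypothesis HPi : simple_roots Pi.

Local Notation W := (subg_of (weyl_group Phi)).
Local Notation S := [set refl a | a in Pi].
Local Notation len := (length Pi).

Implicit Types (a b c r : root_of Phi) (u v w x y z : W).

Definition wact w b : root_of Phi := sgval w b.

Lemma wactM u v b : wact (u * v)%g b = wact v (wact u b).
Proof. by rewrite /wact /= permM. Qed.

Lemma wact1 b : wact 1%g b = b.
Proof. by rewrite /wact /= perm1. Qed.

Lemma wactK u b : wact u^-1 (wact u b) = b.
Proof. by rewrite -wactM mulgV wact1. Qed.

Lemma wactVK u b : wact u (wact u^-1 b) = b.
Proof. by rewrite -wactM mulVg wact1. Qed.

Lemma wact_refl a b : wact (refl a) b = refl_root a b.
Proof. by rewrite /wact /= permE. Qed.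

Lemma val_wact_refl a b :
  ssval (wact (refl a) b) = ssval b - coroot Phi (ssval a) (ssval b) *: ssval a.
Proof. by rewrite wact_refl. Qed.

Lemma wact_ext u v : wact u =1 wact v -> u = v.
Proof. by move=> uv; apply/subg_inj/permP. Qed.

Lemma refl_sqr a : (refl a * refl a = 1)%g.
Proof.
by apply: wact_ext => b; rewrite wactM !wact_refl refl_rootK wact1.
Qed.

Lemma reflV a : (refl a)^-1%g = refl a.
Proof. by apply/eqP; rewrite eq_invg_mul refl_sqr. Qed.

Lemma reflK a w : (refl a * (refl a * w) = w)%g.
Proof. by rewrite mulgA refl_sqr mul1g. Qed.

Lemma root_neq0 b : ssval b != 0.
Proof.
apply/eqP => b0; move: (roots_neq0 Phi); rewrite -b0.
by move/negP; apply; exact: ssvalP b.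
Qed.

Lemma refl_self a : ssval (wact (refl a) a) = - ssval a.
Proof.
rewrite val_wact_refl (coroot_root (ssvalP a)) scaler_nat mulr2n.
by rewrite opprD addrA subrr sub0r.
Qed.

(** The Weyl group is defined by the reflections in all roots, so the induction uses arbitrary
    [refl a]; generation by the simple ones is only available from [parabolicT] on. *)
Lemma weyl_ind (Q : W -> Prop) :
  Q 1%g -> (forall a w, Q w -> Q (refl a * w)%g) -> forall w, Q w.
Proof.
move=> Q1 QM w.
have /gen_prodgP[n [c cS wE]] := subgP w.
elim: n c cS w wE => [|n IHn] c cS w wE.
  rewrite big_ord0 in wE; suff -> : w = 1%g by [].
  exact: subg_inj.
rewrite big_ord_recl in wE.
have /imsetP[a _ ca] := cS ord0.
have -> : w = (refl a * (refl a * w))%g by rewrite reflK.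
apply: QM; apply: (IHn (fun i => c (lift ord0 i))) => [i|]; first exact: cS.
rewrite /= wE ca mulgA.
suff -> : (refl_perm a * refl_perm a = 1)%g by rewrite mul1g.
by apply/permP => b; rewrite permM !permE /= refl_rootK.
Qed.

(** Elements of [W] are only permutations of the roots; this replaces the linearity of their action
    on [V]. Each reflection is given by a linear formula, and the rest is induction. *)
Lemma wact_lincomb (I : finType) (A : {pred I}) (k : I -> F)
    (d : I -> root_of Phi) w b :
  ssval b = \sum_(i in A) k i *: ssval (d i) ->
  ssval (wact w b) = \sum_(i in A) k i *: ssval (wact w (d i)).
Proof.
move: w d b; apply: weyl_ind => [|a w IHw] d b bE.
  by rewrite wact1 bE; apply: eq_bigr => i _; rewrite wact1.
rewrite wactM (IHw (fun i => wact (refl a) (d i))).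
  by apply: eq_bigr => i _; rewrite wactM.
rewrite val_wact_refl bE linear_sum /= scaler_suml -sumrB.
by apply: eq_bigr => i _; rewrite val_wact_refl scalarZ scalerBr !scalerA.
Qed.

Lemma wact_lincomb2 w b c d (j k : F) : ssval b = j *: ssval c + k *: ssval d ->
  ssval (wact w b) = j *: ssval (wact w c) + k *: ssval (wact w d).
Proof.
move=> bE.
have := @wact_lincomb bool predT (fun i => if i then j else k)
  (fun i => if i then c else d) w b.
by rewrite !big_bool /=; apply.
Qed.

Lemma wact_opp w b c : ssval b = - ssval c ->
  ssval (wact w b) = - ssval (wact w c).
Proof.
move=> bE; have := @wact_lincomb2 w b c c (-1) 0.
by rewrite !scale0r !addr0 !scaleN1r; apply.
Qed.

(* Two reflections in the same root differ by a transvection, which permutes the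
   finite set of roots, has finite order, and so is trivial in characteristic
   zero *)
Lemma refl_conj u b : refl (wact u b) = (u^-1 * refl b * u)%g.
Proof.
set g := wact u b; set s := (u^-1 * refl b * u)%g.
have sE c : ssval (wact s c) =
    ssval c - coroot Phi (ssval b) (ssval (wact u^-1 c)) *: ssval g.
  rewrite /s 2!wactM.
  rewrite (@wact_lincomb2 u _ (wact u^-1 c) b 1
    (- coroot Phi (ssval b) (ssval (wact u^-1 c)))).
    by rewrite scale1r wactVK scaleNr.
  by rewrite val_wact_refl scale1r scaleNr.
have sg : ssval (wact s g) = - ssval g.
  rewrite sE /g wactK (coroot_root (ssvalP b)) scaler_nat mulr2n.
  by rewrite opprD addrA subrr sub0r.
have ss : (s * s = 1)%g.
  by rewrite /s !mulgA mulgK -(mulgA u^-1%g) refl_sqr mulg1 mulVg.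
set t := (refl g * s)%g.
suff t1 : t = 1%g.
  by apply/eqP; rewrite -(inj_eq (mulIg s)) -/t t1 ss.
have tg : wact t g = g.
  by apply: val_inj => /=; rewrite /t wactM (wact_opp s (refl_self g)) sg opprK.
have [k tE] : exists k : root_of Phi -> F,
    forall c, ssval (wact t c) = ssval c + k c *: ssval g.
  exists (fun c => coroot Phi (ssval g) (ssval c)
                   - coroot Phi (ssval b) (ssval (wact u^-1 c))) => c.
  rewrite /t wactM.
  rewrite (@wact_lincomb2 s _ c g 1 (- coroot Phi (ssval g) (ssval c))).
    rewrite scale1r sg sE scalerN scaleNr opprK scalerBl.
    by rewrite -addrA; congr (_ + _); rewrite addrC.
  by rewrite val_wact_refl scale1r scaleNr.
have tn n c : ssval (wact (t ^+ n)%g c) = ssval c + (k c *+ n) *: ssval g.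
  elim: n => [|n IHn]; first by rewrite expg0 wact1 mulr0n scale0r addr0.
  rewrite expgSr wactM (@wact_lincomb2 t _ c g 1 (k c *+ n)).
    by rewrite tg tE scale1r mulrS scalerDl addrA.
  by rewrite IHn scale1r.
apply: wact_ext => c; rewrite wact1; apply: val_inj => /=; rewrite tE.
have := tn #[t]%g c; rewrite expg_order wact1 => /eqP.
rewrite eq_sym -subr_eq0 addrC addKr scaler_eq0 (negPf (root_neq0 g)) orbF.
rewrite mulrn_eq0 -leqn0 leqNgt order_gt0 /= => /eqP ->.
by rewrite scale0r addr0.
Qed.

Lemma refl_opp a b : ssval b = - ssval a -> refl b = refl a.
Proof.
move=> bE; have -> : b = wact (refl a) a.
  by apply: val_inj => /=; rewrite bE refl_self.
by rewrite refl_conj reflV refl_sqr mul1g.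
Qed.

(** * Coordinates in the basis of simple roots and positivity *)

Definition simple_tuple := [tuple ssval (enum_val i) | i < #|Pi|].

(* The coordinate of v at the simple root a *)
Definition cf a (v : V) : F :=
  \sum_(i < #|Pi| | enum_val i == a) coord simple_tuple i v.

Fact cf_is_scalar a : scalar (cf a).
Proof.
move=> k u v; rewrite /cf mulr_sumr -big_split /=.
by apply: eq_bigr => i _; rewrite linearP.
Qed.
HB.instance Definition _ a :=
  GRing.isLinear.Build F V F *%R (cf a) (cf_is_scalar a).

Lemma cfZ a k (v : V) : cf a (k *: v) = k * cf a v.
Proof. exact: scalarZ. Qed.

Lemma cfN a (v : V) : cf a (- v) = - cf a v.
Proof. exact: linearN. Qed.

Lemma cfB a (u v : V) : cf a (u - v) = cf a u - cf a v.
Proof. exact: linearB. Qed.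

Lemma simple_basis : basis_of fullv simple_tuple.
Proof.
case: HPi => + _; suff -> : [seq ssval a | a <- enum Pi] = simple_tuple by [].
apply: (@eq_from_nth _ 0) => [|i]; rewrite size_map -cardE ?size_tuple // => iP.
have -> : simple_tuple`_i = tnth simple_tuple (Ordinal iP).
  by rewrite (tnth_nth 0).
rewrite tnth_mktuple.
pose x0 := enum_val (Ordinal iP).
by rewrite (enum_val_nth x0) (nth_map x0) // -cardE.
Qed.

Lemma cf_sum (v : V) : v = \sum_(a in Pi) cf a v *: ssval a.
Proof.
rewrite {1}(coord_basis simple_basis (memvf v)).
rewrite (partition_big enum_val [in Pi]) => [|i _]; last exact: enum_valP.
apply: eq_bigr => a _; rewrite /cf scaler_suml; apply: eq_bigr => i /eqP <-.
by rewrite -(tnth_nth 0 simple_tuple) tnth_mktuple.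
Qed.

Lemma cf_simple a b : b \in Pi -> cf a (ssval b) = (a == b)%:R.
Proof.
move=> bP; have freeP := basis_free simple_basis.
have -> : ssval b = simple_tuple`_(enum_rank_in bP b).
  by rewrite -(tnth_nth 0 simple_tuple) tnth_mktuple enum_rankK_in.
rewrite /cf (eq_bigr (fun i => (i == enum_rank_in bP b)%:R)) => [|i _];
  last by rewrite coord_free 1?eq_sym.
have [->|ab] := eqVneq a b.
  rewrite (bigD1 (enum_rank_in bP b)) /= ?enum_rankK_in ?eqxx //.
  by rewrite big1 ?addr0 // => i /andP[_ /negPf ->].
rewrite big1 // => i /eqP ia; case: eqP => // iE.
by move: ab; rewrite -ia iE enum_rankK_in ?eqxx.
Qed.

Lemma cf_comb (f : root_of Phi -> F) a : a \in Pi ->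
  cf a (\sum_(b in Pi) f b *: ssval b) = f a.
Proof.
move=> aP; rewrite linear_sum (bigD1 a) //= cfZ cf_simple // eqxx mulr1.
rewrite big1 ?addr0 // => b /andP[bP ba].
by rewrite cfZ cf_simple // eq_sym (negPf ba) mulr0.
Qed.

Definition pos b := [forall a in Pi, 0 <= cf a (ssval b)].

Lemma posP b : reflect (forall a, a \in Pi -> 0 <= cf a (ssval b)) (pos b).
Proof. exact: 'forall_implyP. Qed.

(** One direction is the sign dichotomy in [simple_roots]; for the other, a root whose coordinates
    are both nonnegative and nonpositive would be zero. *)
Lemma nposP b : reflect (forall a, a \in Pi -> cf a (ssval b) <= 0) (~~ pos b).
Proof.
apply: (iffP idP) => [nb a aP|nb].
  case: HPi => _ /(_ b)[c [] /= bE].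
    case/posP: nb => x xP; rewrite bE cf_comb //; exact: ler0n.
  by rewrite bE cfN cf_comb // oppr_le0 ler0n.
apply/posP => pb; have /eqP[] := root_neq0 b; rewrite (cf_sum (ssval b)).
rewrite big1 // => a aP; apply/eqP; rewrite scaler_eq0; apply/orP; left.
by rewrite eq_le pb // nb.
Qed.

Lemma pos_simple a : a \in Pi -> pos a.
Proof. by move=> aP; apply/posP => b bP; rewrite cf_simple // ler0n. Qed.

Lemma pos_opp a b : ssval b = - ssval a -> pos b = ~~ pos a.
Proof.
move=> bE; apply/posP/nposP => h c cP; have := h c cP;
by rewrite bE cfN oppr_ge0.
Qed.

Lemma pos_refl_self a : pos (wact (refl a) a) = ~~ pos a.
Proof. exact/pos_opp/refl_self. Qed.

(** The reflection changes only the coordinate at [a]. If the image were negative, all other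
    coordinates of [b] would vanish, and reducedness would leave only [b = a] or its opposite. *)
Lemma pos_refl a b : a \in Pi -> b != a -> pos b -> pos (wact (refl a) b).
Proof.
move=> aP ba /posP pb; apply/contraT => /nposP nb.
have bE : ssval b = cf a (ssval b) *: ssval a.
  rewrite {1}(cf_sum (ssval b)) (bigD1 a) //= big1 ?addr0 // => c /andP[cP ca].
  apply/eqP; rewrite scaler_eq0; apply/orP; left; rewrite eq_le pb // andbT.
  have := nb c cP; rewrite val_wact_refl cfB cfZ (cf_simple c aP).
  by rewrite (negPf ca) mulr0 subr0.
have := ssvalP b; rewrite {1}bE => /(roots_reduced (ssvalP a))[] k1.
  by case/eqP: ba; apply: val_inj => /=; rewrite bE k1 scale1r.
by have := pb a aP; rewrite k1 oppr_ge0 ler10.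
Qed.

Lemma wact_pos_comb w b (A : {set root_of Phi}) (k : root_of Phi -> F) :
  ssval b = \sum_(a in A) k a *: ssval a -> (forall a, a \in A -> 0 <= k a) ->
  (forall a, a \in A -> pos (wact w a)) -> pos (wact w b).
Proof.
move=> bE k0 pA; apply/posP => c cP.
rewrite (wact_lincomb w bE) linear_sum sumr_ge0 // => a aA /=.
by rewrite cfZ mulr_ge0 ?k0 //; have /posP -> := pA a aA.
Qed.

Lemma wact_neg_comb w b (A : {set root_of Phi}) (k : root_of Phi -> F) :
  ssval b = \sum_(a in A) k a *: ssval a -> (forall a, a \in A -> 0 <= k a) ->
  (forall a, a \in A -> ~~ pos (wact w a)) -> ~~ pos (wact w b).
Proof.
move=> bE k0 pA; apply/nposP => c cP.
rewrite (wact_lincomb w bE) linear_sum sumr_le0 // => a aA /=.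
by rewrite cfZ mulr_ge0_le0 ?k0 //; have /nposP -> := pA a aA.
Qed.

Lemma wact_pos w b : (forall a, a \in Pi -> pos (wact w a)) -> pos b ->
  pos (wact w b).
Proof. by move=> wP /posP pb; apply: wact_pos_comb (cf_sum _) pb wP. Qed.

Lemma wact_neg w b : (forall a, a \in Pi -> ~~ pos (wact w a)) -> pos b ->
  ~~ pos (wact w b).
Proof. by move=> wP /posP pb; apply: wact_neg_comb (cf_sum _) pb wP. Qed.

(** * Inversions, the exchange property and the length *)

Definition inversions w := [set b | pos b && ~~ pos (wact w b)].
Definition ninv w := #|inversions w|.

Lemma ninv1 : ninv 1%g = 0%N.
Proof.
by apply/eqP; rewrite cards_eq0; apply/set0Pn => -[b]; rewrite inE wact1 andbN.
Qed.

(** Sending [b] to the opposite of its image under [u^-1] embeds the inversions of [u^-1] into those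
    of [u]. The opposite of [b] is obtained as [wact (refl b) b]. *)
Lemma ninvV w : ninv w^-1 = ninv w.
Proof.
suff le u : (ninv u^-1 <= ninv u)%N.
  by apply/eqP; rewrite eqn_leq le -{1}[w]invgK le.
have injf : injective (fun b => wact (u^-1)%g (wact (refl b) b)).
  move=> b c /(congr1 (wact u)); rewrite !wactVK => /(congr1 (@ssval _ _)).
  by rewrite !refl_self => /oppr_inj/val_inj.
rewrite /ninv -(card_imset (inversions _) injf) subset_leq_card //.
apply/subsetP => _ /imsetP[b + ->]; rewrite !inE wactVK pos_refl_self.
move=> /andP[pb nb].
by rewrite pb (pos_opp (wact_opp _ (refl_self b))) nb.
Qed.

(** The reflection permutes the positive roots other than [a], hence matches the inversions of the
    two elements other than [a]; [k] is their common number. Exactly one of the two elements has [a]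
    itself as an inversion. *)
Lemma ninv_mull a w : a \in Pi -> exists k,
  ninv (refl a * w)%g = (pos (wact w a) + k)%N /\
  ninv w = (~~ pos (wact w a) + k)%N.
Proof.
move=> aP; exists #|inversions w :\ a|; rewrite /ninv.
rewrite (cardsD1 a) [in X in _ /\ X](cardsD1 a) !inE pos_simple //=.
rewrite wactM (pos_opp (wact_opp _ (refl_self a))) negbK; split=> //.
congr (_ + _)%N.
rewrite -[RHS](card_imset _ (@can_inj _ _ _ _ (wactK (refl a)))).
congr #|pred_of_set _|; apply/setP => b; apply/idP/imsetP => [|[c + ->]];
  rewrite !inE.
  move=> /and3P[ba pb nb]; exists (wact (refl a) b).
    rewrite !inE -wactM nb pos_refl // !andbT; apply/eqP => bE.
    have : ~~ pos b; last by rewrite pb.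
    by rewrite -(wactK (refl a) b) bE reflV pos_refl_self pos_simple.
  by rewrite -[LHS](wactK (refl a)) reflV.
move=> /and3P[ca pc nc]; rewrite -wactM reflK nc pos_refl // !andbT.
apply/eqP => cE; have : ~~ pos c; last by rewrite pc.
by rewrite -(wactK (refl a) c) cE reflV pos_refl_self pos_simple.
Qed.

(** Let [b] be the first letter of the word. If [r = b], that letter cancels; otherwise the image of
    [r] under [refl b] is still positive, and the induction hypothesis deletes a letter further on.
    The root [r] need not be simple, which [parabolicT] relies on. *)
Lemma exchange k w r : (w \in S ^+ k)%g -> pos r -> ~~ pos (wact w r) ->
  (0 < k)%N /\ (refl r * w \in S ^+ k.-1)%g.
Proof.
elim: k w r => [|k IHk] w r.
  by rewrite expg0 inE => /eqP ->; rewrite wact1 => ->.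
rewrite expgS => /mulsgP[_ v /imsetP[b bP ->] vS ->] pr nr; split=> //=.
have [->|rb] := eqVneq r b; first by rewrite reflK.
rewrite wactM in nr.
have [k0] := IHk _ _ vS (pos_refl bP rb pr) nr.
rewrite refl_conj reflV -{2}(prednK k0) expgS => svS.
have -> : (refl r * (refl b * v) =
           refl b * (refl b * refl r * refl b * v))%g.
  by rewrite !mulgA refl_sqr mul1g.
by apply/mulsgP; exists (refl b) (refl b * refl r * refl b * v)%g;
  rewrite ?imset_f.
Qed.

(** Prepending a simple reflection to a word with as many letters as inversions either adds an
    inversion or, by [exchange], amounts to deleting a letter. *)
Lemma ninv_reduced k w : (w \in S ^+ k)%g ->
  (w \in S ^+ (ninv w))%g /\ (ninv w <= k)%N.
Proof.
elim: k w => [|k IHk] w.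
  by rewrite expg0 inE => /eqP ->; rewrite ninv1 expg0 set11.
rewrite expgS => /mulsgP[_ v /imsetP[a aP ->] vS ->].
have [v'S vk] := IHk _ vS; have [j [-> vE]] := ninv_mull v aP.
rewrite vE in vk v'S; have [pv|nv] := boolP (pos (wact v a)).
  rewrite pv add0n in vk v'S; rewrite /= expgS ltnS; split=> //.
  by apply/mulsgP; exists (refl a) v; rewrite ?imset_f.
rewrite nv add1n in vk v'S.
have [_ h] := exchange v'S (pos_simple aP) nv; split=> //.
by rewrite add0n ltnW // ltnW.
Qed.

Lemma parabolic_set k (A : {set root_of Phi}) w :
  (w \in [set refl a | a in A] ^+ k)%g -> w \in parabolic A.
Proof.
elim: k w => [|k IHk] w; first by rewrite expg0 inE => /eqP ->; apply: group1.
rewrite expgS => /mulsgP[u v uS vS ->].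
by apply: groupM; [exact: mem_gen | exact: IHk].
Qed.

Lemma parabolic_ex w (A : {set root_of Phi}) : w \in parabolic A ->
  exists k, (w \in [set refl a | a in A] ^+ k)%g.
Proof.
move=> wA; have [k] := length_ex A w; rewrite wA.
by exists k.
Qed.

Lemma refl_parabolic (A : {set root_of Phi}) a : a \in A ->
  refl a \in parabolic A.
Proof. by move=> aA; apply/mem_gen/imset_f. Qed.

(* An element of [parabolic Pi] with the most inversions makes every positive root
   negative, so that the exchange lemma applies to it and to every reflection *)
Lemma parabolicT : parabolic Pi = [set: W] :> {set W}.
Proof.
apply/setP => w; rewrite inE; move: w.
pose w0 := [arg max_(w > 1%g in parabolic Pi) ninv w].
have [w0P w0max] : w0 \in parabolic Pi /\
    forall w, w \in parabolic Pi -> (ninv w <= ninv w0)%N.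
  by rewrite /w0; case: arg_maxnP => [|w wP wM]; first exact: group1.
have w0neg a : a \in Pi -> ~~ pos (wact w0 a).
  move=> aP; have [k [] + +] := ninv_mull w0 aP.
  have := w0max (refl a * w0)%g; rewrite groupM ?refl_parabolic // => /(_ isT).
  by case: pos => // /[swap] ->  /[swap] ->; rewrite add0n add1n ltnn.
have [k w0S] := parabolic_ex w0P.
apply: weyl_ind => [|a w wP]; first exact: group1.
rewrite groupMr //.
wlog pa : a / pos a => [IH|].
  case: (boolP (pos a)) => [/IH //|na].
  rewrite -(refl_opp (refl_self a)); apply: IH.
  by rewrite pos_refl_self.
have [_ /parabolic_set] := exchange w0S pa (wact_neg w0neg pa).
by rewrite groupMr.
Qed.

Lemma length_ninv w : len w = ninv w.
Proof.
have wP : w \in parabolic Pi by rewrite parabolicT inE.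
rewrite /length; case: ex_minnP => m; rewrite wP /= => wm mmin.
have [wn nm] := ninv_reduced wm.
by apply/eqP; rewrite eqn_leq nm mmin // wn implybT.
Qed.

Lemma length1 : len 1%g = 0%N.
Proof. by rewrite length_ninv ninv1. Qed.

Lemma lengthV w : len w^-1%g = len w.
Proof. by rewrite !length_ninv ninvV. Qed.

Lemma length_eq0 w : len w = 0%N -> w = 1%g.
Proof.
have wP : w \in parabolic Pi by rewrite parabolicT inE.
have [k /ninv_reduced[]] := parabolic_ex wP.
by rewrite length_ninv => + _ => /[swap] ->; rewrite expg0 => /set1P.
Qed.

Lemma length_refll a w : a \in Pi -> exists k,
  len (refl a * w)%g = (pos (wact w a) + k)%N /\
  len w = (~~ pos (wact w a) + k)%N.
Proof. by move=> aP; rewrite !length_ninv; apply: ninv_mull. Qed.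

Lemma length_reflr a w : a \in Pi -> exists k,
  len (w * refl a)%g = (pos (wact w^-1%g a) + k)%N /\
  len w = (~~ pos (wact w^-1%g a) + k)%N.
Proof.
by move=> aP; rewrite -lengthV invMg reflV -(lengthV w); apply: length_refll.
Qed.

(** Without a descent, [w^-1] would keep all simple roots positive, hence have no inversion. *)
Lemma descent_ex w : w != 1%g ->
  exists2 a, a \in Pi & (len (w * refl a)%g < len w)%N.
Proof.
move=> w1.
have [a /andP[aP nw]|h] := pickP [pred a in Pi | ~~ pos (wact w^-1%g a)].
  exists a => //; have [k [-> ->]] := length_reflr w aP.
  by rewrite (negPf nw).
case/eqP: w1; apply: length_eq0; rewrite -lengthV length_ninv.
apply/eqP; rewrite cards_eq0; apply/set0Pn => -[b]; rewrite inE => /andP[pb].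
apply/negP; rewrite negbK; apply: wact_pos pb => a aP.
by have := h a; rewrite /= aP => /negbFE.
Qed.

(** * Parabolic subgroups and their cosets *)

Section Parabolic.

Variable Theta : {set root_of Phi}.
Hypothesis ThetaPi : Theta \subset Pi.

Local Notation WT := (parabolic Theta).
Local Notation wT := (longest Pi WT).

Let theta_simple a : a \in Theta -> a \in Pi.
Proof. exact: (subsetP ThetaPi). Qed.

Lemma parabolic_ind (Q : W -> Prop) :
  Q 1%g -> (forall a w, a \in Theta -> w \in WT -> Q w -> Q (refl a * w)%g) ->
  forall w, w \in WT -> Q w.
Proof.
move=> Q1 QM w /parabolic_ex[k]; elim: k w => [|k IHk] w.
  by rewrite expg0 inE => /eqP ->.
rewrite expgS => /mulsgP[_ v /imsetP[a aP ->] vS ->].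
by apply: QM => //; [exact: parabolic_set vS | exact: IHk].
Qed.

(** A reflection in a root of [Theta] changes only the coordinate at that root. *)
Lemma cf_parabolic w b (x : root_of Phi) :
  w \in WT -> x \in Pi -> x \notin Theta ->
  cf x (ssval (wact w b)) = cf x (ssval b).
Proof.
move=> wP xP xT; move: w wP b; apply: parabolic_ind => [|a w aT wP IHw] b.
  by rewrite wact1.
rewrite wactM IHw val_wact_refl cfB cfZ (cf_simple x (theta_simple aT)).
have /negPf -> : x != a by apply: contra xT => /eqP ->.
by rewrite mulr0 subr0.
Qed.

(** The root subsystem spanned by [Theta]. *)
Definition theta_root b :=
  [forall x in Pi, (x \notin Theta) ==> (cf x (ssval b) == 0)].

Lemma theta_rootP b : reflect
  (forall x : root_of Phi, x \in Pi -> x \notin Theta -> cf x (ssval b) = 0)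
  (theta_root b).
Proof.
apply: (iffP 'forall_implyP) => h x xP; last by apply/implyP => xT; rewrite h.
by move/(implyP (h x xP))/eqP.
Qed.

Lemma theta_root_simple a : a \in Theta -> theta_root a.
Proof.
move=> aT; apply/theta_rootP => x xP xT; rewrite cf_simple ?theta_simple //.
by case: eqP xT => // ->; rewrite aT.
Qed.

Lemma theta_root_wact w b : w \in WT -> theta_root (wact w b) = theta_root b.
Proof.
move=> wP; apply/theta_rootP/theta_rootP => h x xP xT.
  by rewrite -(cf_parabolic b wP) ?h.
by rewrite (cf_parabolic b wP) ?h.
Qed.

Lemma theta_root_sum b : theta_root b ->
  ssval b = \sum_(a in Theta) cf a (ssval b) *: ssval a.
Proof.
move/theta_rootP => h; rewrite {1}(cf_sum (ssval b)) (big_setID Theta) /=.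
rewrite (setIidPr ThetaPi) [X in _ + X]big1 ?addr0 // => a /setDP[aP aT].
by rewrite h // scale0r.
Qed.

Lemma wact_theta_pos w b : (forall a, a \in Theta -> pos (wact w a)) ->
  theta_root b -> pos (wact w b) = pos b.
Proof.
have aux c : (forall a, a \in Theta -> pos (wact w a)) -> theta_root c ->
    pos c -> pos (wact w c).
  move=> wP ct /posP pc; apply: wact_pos_comb (theta_root_sum ct) _ wP.
  by move=> a /theta_simple; exact: pc.
move=> wP bt; apply/idP/idP; last exact: aux.
apply: contraLR => nb; rewrite -(pos_opp (wact_opp w (refl_self b))).
apply: aux => //; last by rewrite pos_refl_self.
apply/theta_rootP => x xP xT.
by rewrite refl_self cfN (theta_rootP b bt) // oppr0.
Qed.

Lemma wact_theta_neg w b : (forall a, a \in Theta -> ~~ pos (wact w a)) ->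
  theta_root b -> pos (wact w b) = ~~ pos b.
Proof.
have aux c : (forall a, a \in Theta -> ~~ pos (wact w a)) -> theta_root c ->
    pos c -> ~~ pos (wact w c).
  move=> wP ct /posP pc; apply: wact_neg_comb (theta_root_sum ct) _ wP.
  by move=> a /theta_simple; exact: pc.
move=> wP bt; apply/idP/idP; first exact/contraL/aux.
move=> nb; rewrite -[X in is_true X]negbK.
rewrite -(pos_opp (wact_opp w (refl_self b))).
apply: aux => //; last by rewrite pos_refl_self.
apply/theta_rootP => x xP xT.
by rewrite refl_self cfN (theta_rootP b bt) // oppr0.
Qed.

(* This says that y is the shortest element of its right coset [WT :* y] *)
Definition min_rep y := [forall a in Theta, pos (wact y a)].

Lemma min_repP y :
  reflect (forall a, a \in Theta -> pos (wact y a)) (min_rep y).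
Proof. exact: 'forall_implyP. Qed.

(** Induction on [z]: the image of [a] under [z] lies in the subsystem of [Theta], where [y]
    preserves signs, so prepending [refl a] lengthens [z * y] exactly when it lengthens [z]. *)
Lemma length_mul z y : z \in WT -> min_rep y ->
  len (z * y)%g = (len z + len y)%N.
Proof.
move=> zP /min_repP ym; move: z zP; apply: parabolic_ind => [|a z aT zP IHz].
  by rewrite mul1g length1.
have [j [jE jE']] := length_refll (z * y)%g (theta_simple aT).
have [k [kE kE']] := length_refll z (theta_simple aT).
rewrite -mulgA jE kE; move: jE' kE'; rewrite IHz wactM (wact_theta_pos ym).
  by move=> + kE' => /eqP; rewrite kE' -!addnA eqn_add2l => /eqP <-.
by rewrite theta_root_wact // theta_root_simple.
Qed.

Lemma min_rep_le y : (forall z, z \in WT -> len y <= len (z * y)%g)%N ->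
  min_rep y.
Proof.
move=> ymin; apply/min_repP => a aT; apply/contraT => na.
have [k [sE E]] := length_refll y (theta_simple aT).
have := ymin _ (refl_parabolic aT).
by rewrite sE E (negPf na) add0n add1n ltnn.
Qed.

Lemma longest_in (A : {set W}) w : w \in A ->
  longest Pi A \in A /\ (len w <= len (longest Pi A))%N.
Proof.
move=> wA; rewrite /longest; case: arg_maxnP => [|x xA xM].
  exact: mem_repr wA.
by split; last exact: xM.
Qed.

Lemma parabolic_longest_neg u : u \in WT ->
  (forall v, v \in WT -> len v <= len u)%N ->
  forall a, a \in Theta -> ~~ pos (wact u a).
Proof.
move=> uT umax a aT; have [k [sE E]] := length_refll u (theta_simple aT).
have := umax _ (groupM (refl_parabolic aT) uT); rewrite sE E.
by case: pos => //; rewrite add0n add1n ltnn.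
Qed.

(** The quotient [u^-1 * v] has no inversions: on the subsystem of [Theta] the two sign changes
    cancel, and any other positive root has a nonzero coordinate outside [Theta], which [WT] does
    not alter. *)
Lemma parabolic_neg_uniq u v : u \in WT -> v \in WT ->
  (forall a, a \in Theta -> ~~ pos (wact u a)) ->
  (forall a, a \in Theta -> ~~ pos (wact v a)) -> u = v.
Proof.
move=> uT vT un vn; apply/eqP; rewrite eq_mulVg1; apply/eqP.
apply: length_eq0; rewrite length_ninv; apply/eqP; rewrite cards_eq0.
apply/set0Pn => -[b]; rewrite inE wactM => /andP[pb].
have uvT : (u^-1 * v)%g \in WT by rewrite groupM ?groupV.
have ct : theta_root (wact u^-1%g b) = theta_root b.
  by rewrite theta_root_wact ?groupV.
have [bt|] := boolP (theta_root b).
  have := wact_theta_neg un; move=> /(_ (wact u^-1%g b)).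
  by rewrite ct wactVK pb (wact_theta_neg vn) ?ct // => <-.
rewrite negb_forall => /existsP[x]; rewrite negb_imply => /andP[xP].
rewrite negb_imply => /andP[xT x0] /nposP/(_ x xP).
rewrite -wactM cf_parabolic //; have /posP/(_ x xP) := pb.
by move=> h1 h2; case/eqP: x0; apply/eqP; rewrite eq_le h1 h2.
Qed.

Lemma parabolic_longest_uniq u : u \in WT ->
  (forall v, v \in WT -> len v <= len u)%N -> u = wT.
Proof.
have [wTin _] := longest_in (group1 WT).
move=> uT umax; apply: parabolic_neg_uniq => //.
  exact: parabolic_longest_neg.
by apply: parabolic_longest_neg => // v /longest_in[].
Qed.

Lemma longest_parabolic_sqr : (wT * wT = 1)%g.
Proof.
have [wTin _] := longest_in (group1 WT).
apply/eqP; rewrite -eq_invg_mul; apply/eqP; apply: parabolic_longest_uniq.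
  by rewrite groupV.
by move=> v /longest_in[_]; rewrite lengthV.
Qed.

(** * Cosets and their shortest and longest elements *)

Definition shortest (C : cosets Theta) : W :=
  [arg min_(w < repr (val C) in val C) len w].

Implicit Types C D : cosets Theta.

Local Notation cls := (coset_cls Theta).

Lemma cls_eq u v : (cls u == cls v) = ((u * v^-1)%g \in WT).
Proof. by rewrite -mem_rcoset -val_eqE; apply/eqP/rcoset_eqP. Qed.

Lemma cls_mul z w : z \in WT -> cls (z * w)%g = cls w.
Proof. by move=> zT; apply/eqP; rewrite cls_eq mulgK. Qed.

Lemma coset_mul_cls w u : Defs.coset_mul (cls w) u = cls (w * u)%g.
Proof. by apply: val_inj; rewrite /= rcosetM. Qed.

Lemma coset_mul_reflK C a :
  Defs.coset_mul (Defs.coset_mul C (refl a)) (refl a) = C.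
Proof. by apply: val_inj; rewrite /= -rcosetM refl_sqr rcoset1. Qed.

Lemma mem_coset (C : cosets Theta) w : (w \in val C) = (cls w == C).
Proof.
have /rcosetsP[u _ uE] := valP C.
by rewrite uE -val_eqE uE; apply/rcoset_eqP/eqP.
Qed.

Lemma shortest_spec C :
  shortest C \in val C /\
  forall w, w \in val C -> (len (shortest C) <= len w)%N.
Proof.
have /rcosetsP[u _ uE] := valP C.
rewrite /shortest; case: arg_minnP => [|x xA xM]; last by split.
by apply: (mem_repr u); rewrite uE rcoset_refl.
Qed.

Lemma cls_shortest C : cls (shortest C) = C.
Proof. by apply/eqP; rewrite -mem_coset; case: (shortest_spec C). Qed.

Lemma shortest_min_rep C : min_rep (shortest C).
Proof.
apply: min_rep_le => z zT; have [_] := shortest_spec C; apply.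
by rewrite mem_coset cls_mul // cls_shortest.
Qed.

(** The shortest element is [z * y] with [z] in [WT]; additivity of lengths forces [z] to have
    length 0. *)
Lemma shortest_cls y : min_rep y -> shortest (cls y) = y.
Proof.
move=> ym; have := cls_shortest (cls y); set x := shortest _.
move/eqP; rewrite cls_eq => zT.
have xE : x = (x * y^-1 * y)%g by rewrite mulgKV.
have := length_mul zT ym; rewrite -xE => xy.
have : (len x <= len y)%N.
  by case: (shortest_spec (cls y)) => _; apply; rewrite mem_coset.
rewrite xy -{2}[len y]add0n leq_add2r leqn0 => /eqP/length_eq0 h.
by rewrite xE h mul1g.
Qed.

Lemma coset_decomp w :
  exists2 z, z \in WT & w = (z * shortest (cls w))%g.
Proof.
exists (w * (shortest (cls w))^-1)%g; last by rewrite mulgKV.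
by rewrite -cls_eq cls_shortest.
Qed.

(** If the positive root [wact y c] became negative under [refl a], it would be [a], and then
    [y * refl a = refl c * y] would lie in the coset of [y]. *)
Lemma min_rep_reflr y a :
  a \in Pi -> min_rep y -> cls (y * refl a)%g != cls y ->
  min_rep (y * refl a)%g.
Proof.
move=> aP /min_repP ym yay; apply/min_repP => c cT; rewrite wactM.
apply: pos_refl => //; last exact: ym.
apply: contra yay => /eqP yc; rewrite cls_eq -yc refl_conj.
by rewrite !mulgA mulgV mul1g mulgK refl_parabolic.
Qed.

(** As lengths add, an element of the coset is longest when its factor in [WT] is. *)
Lemma longest_coset C : longest Pi (val C) = (wT * shortest C)%g.
Proof.
have [wTin _] := longest_in (group1 WT).
have ym := shortest_min_rep C.
have : (wT * shortest C)%g \in val C.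
  by rewrite mem_coset cls_mul // cls_shortest.
move/longest_in => []; rewrite mem_coset => /eqP lC.
have [z zT] := coset_decomp (longest Pi (val C)); rewrite lC => ->.
rewrite !length_mul // leq_add2r => le; congr (_ * _)%g.
apply: parabolic_longest_uniq => // v /longest_in[_] vl.
exact: leq_trans vl le.
Qed.

Lemma length_longest C :
  len (longest Pi (val C)) = (len wT + len (shortest C))%N.
Proof.
rewrite longest_coset length_mul ?shortest_min_rep //.
by case: (longest_in (group1 WT)).
Qed.

Lemma longest_coset_inj C D :
  longest Pi (val C) = longest Pi (val D) -> C = D.
Proof.
rewrite !longest_coset => /mulgI CD.
by rewrite -(cls_shortest C) CD cls_shortest.
Qed.

Lemma refl_neq1 a : refl a != 1%g.
Proof.
apply/eqP => ra; have := pos_refl_self a; rewrite ra wact1.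
by case: pos.
Qed.

(** * The order on cosets and multiplication by a simple reflection *)

Lemma bruhat_length x y : bruhat Pi x y -> x = y \/ (len x < len y)%N.
Proof.
case/connectP => p; elim: p x => [|u p IHp] x /=; first by left.
case/andP => /andP[_ xu] /IHp h /h{h}[<-|uy]; right=> //.
exact: ltn_trans uy.
Qed.

Lemma bruhat_reflr a w :
  bruhat Pi w (w * refl a)%g = (len w < len (w * refl a))%N.
Proof.
apply/idP/idP => [/bruhat_length[/eqP|//]|ww].
  by rewrite eq_mulVg1 mulKg (negPf (refl_neq1 a)).
by apply: connect1; rewrite ww andbT; apply/existsP; exists a.
Qed.

Lemma coset_lt_length C D : coset_lt Pi C D ->
  (len (shortest C) < len (shortest D))%N.
Proof.
case/andP => CD /bruhat_length[/longest_coset_inj/eqP|].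
  by rewrite (negPf CD).
by rewrite !length_longest ltn_add2l.
Qed.

Lemma coset_le_refl C : coset_le Pi C C.
Proof. exact: connect0. Qed.

Lemma coset_le_anti C D : coset_le Pi C D -> coset_le Pi D C -> C = D.
Proof.
move=> CD DC; apply/eqP/contraT => nCD.
have := @coset_lt_length C D; rewrite /coset_lt nCD CD => /(_ isT).
have := @coset_lt_length D C; rewrite /coset_lt eq_sym nCD DC => /(_ isT).
by move=> h /(ltn_trans h); rewrite ltnn.
Qed.

Lemma shortest_reflr C a : a \in Pi -> Defs.coset_mul C (refl a) != C ->
  shortest (Defs.coset_mul C (refl a)) = (shortest C * refl a)%g.
Proof.
have ym := shortest_min_rep C.
rewrite -{1 2 3}(cls_shortest C) coset_mul_cls => aP nC.
by rewrite shortest_cls // min_rep_reflr.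
Qed.

(** The longest elements of the two cosets differ by one reflection, so their Bruhat comparison is a
    comparison of lengths. *)
Lemma coset_lt_reflr C a : a \in Pi -> Defs.coset_mul C (refl a) != C ->
  coset_lt Pi C (Defs.coset_mul C (refl a)) =
  (len (shortest C) < len (shortest C * refl a))%N.
Proof.
move=> aP nC; rewrite /coset_lt eq_sym nC /coset_le !longest_coset.
have wTin : wT \in WT by case: (longest_in (group1 WT)).
rewrite (shortest_reflr aP nC) mulgA bruhat_reflr -mulgA.
rewrite -(shortest_reflr aP nC).
by rewrite !length_mul ?shortest_min_rep // ltn_add2l.
Qed.

(** With [y] the shortest element, [y * refl a] is not minimal in the coset, so [refl a] makes some
    positive root [wact y c] negative; that root must be [a], and conjugating gives the equation. *)
Lemma shortest_reflr_fix C a : a \in Pi -> Defs.coset_mul C (refl a) = C ->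
  exists2 c, c \in Theta & (shortest C * refl a = refl c * shortest C)%g.
Proof.
move=> aP CaC; set y := shortest C.
have ym : min_rep y := shortest_min_rep C.
have yC : cls y = C := cls_shortest C.
have [yam|] := boolP (min_rep (y * refl a)%g).
  have := shortest_cls yam; rewrite -coset_mul_cls yC CaC -/y => /eqP.
  by rewrite eq_mulVg1 mulKg (negPf (refl_neq1 a)).
rewrite negb_forall => /existsP[c]; rewrite negb_imply => /andP[cT nc].
exists c => //; have [ycE|yca] := eqVneq (wact y c) a.
  by rewrite -ycE refl_conj !mulgA mulgV mul1g.
by move: nc; rewrite wactM pos_refl // (min_repP _ ym).
Qed.

End Parabolic.

End Roots.


(** * Whittaker Kazhdan-Lusztig families *)

Fact laurent_poly_is_zmod_morphism : zmod_morphism laurent_poly.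
Proof. by move=> p r; apply: val_inj; rewrite /= tofracB. Qed.

Fact laurent_poly_is_monoid_morphism : monoid_morphism laurent_poly.
Proof.
by split=> [|p r]; apply: val_inj; rewrite /= ?tofrac1 ?tofracM.
Qed.

HB.instance Definition _ :=
  GRing.isZmodMorphism.Build {poly int} laurent laurent_poly
    laurent_poly_is_zmod_morphism.
HB.instance Definition _ :=
  GRing.isMonoidMorphism.Build {poly int} laurent laurent_poly
    laurent_poly_is_monoid_morphism.

Lemma laurent_poly_inj : injective laurent_poly.
Proof.
move=> p r /(congr1 val) /= /eqP.
by rewrite tofrac_eq => /eqP.
Qed.

Lemma laurent_poly0 : laurent_poly 0 = 0.
Proof. exact: rmorph0. Qed.

Lemma laurent_poly1 : laurent_poly 1 = 1.
Proof. exact: rmorph1. Qed.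

Section HeckeModule.

Variables (F : numFieldType) (V : vectType F) (Phi : reduced_root_system V).
Variable Pi : {set root_of Phi}.
Hypothesis HPi : simple_roots Pi.
Variable Theta : {set root_of Phi}.
Hypothesis ThetaPi : Theta \subset Pi.

Local Notation W := (subg_of (weyl_group Phi)).
Local Notation len := (length Pi).
Local Notation cls := (coset_cls Theta).
Local Notation shortest := (shortest Pi).

Implicit Types (a : root_of Phi) (C D E : cosets Theta).

Lemma deltaE C D : delta C D = (C == D)%:R :> laurent.
Proof. by rewrite ffunE. Qed.

Fact hecke_T_is_linear a : linear (hecke_T Pi a : hecke_module Theta -> _).
Proof.
move=> k h g; rewrite /hecke_T scaler_sumr -big_split /=.
by apply: eq_bigr => C _; rewrite !ffunE scalerDl scalerA.
Qed.
HB.instance Definition _ a :=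
  GRing.isLinear.Build laurent (hecke_module Theta) (hecke_module Theta) *:%R
    (hecke_T Pi a) (hecke_T_is_linear a).

Lemma hecke_module_sum (h : hecke_module Theta) :
  h = \sum_C (h C : laurent) *: delta C.
Proof.
apply/ffunP => D; rewrite sum_ffunE (bigD1 D) //= big1 ?addr0.
  by rewrite !ffunE eqxx /GRing.scale /= mulr1.
by move=> C /negPf CD; rewrite !ffunE CD /GRing.scale /= mulr0.
Qed.

Lemma hecke_T_deltaE a C : hecke_T Pi a (delta C) = hecke_T_delta Pi a C.
Proof.
rewrite /hecke_T (bigD1 C) //= big1 => [|D DC].
  by rewrite deltaE eqxx scale1r addr0.
by rewrite deltaE eq_sym (negPf DC) scale0r.
Qed.

Variable P : cosets Theta -> cosets Theta -> {poly int}.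
Hypothesis HP : whittaker_kl Pi P.

Local Notation phi := (whittaker_phi Pi P).

Lemma whittaker_phiE C D : phi C D = laurent_poly (P C D) :> laurent.
Proof.
rewrite /whittaker_phi ffunE sum_ffunE deltaE.
have [<-|CD] := eqVneq C D.
  rewrite (wkl_diag HP) laurent_poly1 big1 ?addr0 // => E /andP[EC _].
  by rewrite ffunE deltaE (negPf EC) /GRing.scale /= mulr0.
rewrite add0r; have [lt|nlt] := boolP (coset_lt Pi D C).
  rewrite (bigD1 D) //= big1 ?addr0 => [|E /andP[_ ED]].
    by rewrite ffunE deltaE eqxx /GRing.scale /= mulr1.
  by rewrite ffunE deltaE (negPf ED) /GRing.scale /= mulr0.
rewrite (wkl_nle HP); last by move: nlt; rewrite /coset_lt eq_sym CD.
rewrite laurent_poly0 big1 // => E ltE; rewrite ffunE deltaE.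
case: eqP => [ED|_]; last by rewrite /GRing.scale /= mulr0.
by rewrite -ED ltE in nlt.
Qed.

Lemma wkl_horner0 C D : (P C D).[0] = (C == D)%:R.
Proof.
have [->|CD] := eqVneq C D; first by rewrite (wkl_diag HP) hornerC.
have [le|nle] := boolP (coset_le Pi D C); last by rewrite (wkl_nle HP) ?horner0.
have [|p ->] := wkl_lt HP (C := C) (D := D).
  by rewrite /coset_lt eq_sym CD.
by rewrite hornerM hornerX mul0r.
Qed.

(** The matrix [P] is the identity modulo q, so [n E] is the constant term of the coefficient at
    [E]. *)
Lemma phi_comb_eq0 (n : cosets Theta -> int) (p : cosets Theta -> {poly int}) :
  (forall E, (\sum_D (n D)%:~R *: phi D) E = laurent_poly (p E)) ->
  (forall E, (p E).[0] = 0) -> forall E, n E = 0.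
Proof.
move=> np p0 E; rewrite -(p0 E).
have <- : \sum_D (n D)%:~R * P D E = p E.
  apply: laurent_poly_inj; rewrite -np sum_ffunE rmorph_sum.
  apply: eq_bigr => D _.
  by rewrite rmorphM rmorph_int ffunE whittaker_phiE.
rewrite horner_sum (bigD1 E) //= big1 => [|D DE].
  rewrite hornerM wkl_horner0 eqxx mulr1 addr0.
  by rewrite -[RHS]/(horner_eval 0 _) rmorph_int intz.
by rewrite hornerM wkl_horner0 (negPf DE) mulr0.
Qed.

Lemma whittaker_phi1 : phi (cls 1%g) = delta (cls 1%g).
Proof.
rewrite /whittaker_phi big_pred0 ?addr0 // => D; apply/negP.
move/(coset_lt_length HPi ThetaPi).
rewrite (shortest_cls HPi ThetaPi) ?(length1 HPi) //.
apply/min_repP => a aT; rewrite wact1; apply: pos_simple => //.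
exact: (subsetP ThetaPi).
Qed.

(** Property (ii) with its leading coefficient made explicit: comparing the coefficients at [C]
    shows that [c C] is 1. *)
Lemma wkl_step a C : a \in Pi ->
  (len (shortest C * refl a) < len (shortest C))%N ->
  Defs.coset_mul C (refl a) != C ->
  exists c : cosets Theta -> int,
    hecke_T Pi a (phi (Defs.coset_mul C (refl a))) =
    phi C + \sum_(D | coset_lt Pi D C) (c D)%:~R *: phi D.
Proof.
move=> aP lt Ca; set B := Defs.coset_mul C (refl a).
have BK : Defs.coset_mul B (refl a) = C.
  exact: coset_mul_reflK.
have ltBC : coset_lt Pi B C.
  have := coset_lt_reflr HPi ThetaPi (C := B) aP; rewrite BK eq_sym => -> //.
  by rewrite (shortest_reflr HPi ThetaPi) // -mulgA refl_sqr mulg1.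
have [c cE] := wkl_T HP aP ltBC; exists c.
rewrite -/B cE (bigD1 C) ?coset_le_refl //=; congr (_ + _); last first.
  by apply: eq_bigl => D; rewrite /coset_lt andbC.
suff -> : (c C)%:~R = 1 :> laurent by rewrite scale1r.
(* On the right, only [phi C] has a nonzero coefficient at [C]. *)
have <- : (\sum_(D | coset_le Pi D C) (c D)%:~R *: phi D) C
          = (c C)%:~R :> laurent.
  rewrite sum_ffunE (bigD1 C) ?coset_le_refl //= big1 => [|D /andP[DC DnC]].
    rewrite addr0 ffunE whittaker_phiE (wkl_diag HP) laurent_poly1.
    by rewrite /GRing.scale /= mulr1.
  rewrite ffunE whittaker_phiE (wkl_nle HP) ?laurent_poly0 ?scaler0 //.
  by apply: contra DnC => CD; apply/eqP; exact: (coset_le_anti HPi ThetaPi).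
rewrite -cE -/B.
(* On the left, only [delta B] contributes at [C], with coefficient 1: another [delta E] could
   contribute only for [E = C], and [C] does not occur in [phi B]. *)
rewrite /hecke_T sum_ffunE (bigD1 B) //= big1 => [|E EB].
  rewrite addr0 ffunE whittaker_phiE (wkl_diag HP) laurent_poly1 scale1r.
  rewrite /hecke_T_delta BK eq_sym (negPf Ca).
  by case: ifP => _; rewrite !ffunE (negPf Ca) eqxx scaler0 add0r.
rewrite ffunE whittaker_phiE.
have [->|EC] := eqVneq E C.
  rewrite (wkl_nle HP) ?laurent_poly0 ?scale0r //.
  apply/negP => CB; case/andP: ltBC => /eqP nBC BC.
  by case: nBC; exact: (coset_le_anti HPi ThetaPi).
rewrite /hecke_T_delta /=.
have EaC : Defs.coset_mul E (refl a) == C = false.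
  apply/eqP => EaC; case/eqP: EB; rewrite /B -EaC.
  by rewrite coset_mul_reflK.
have [EaE|EaE] := eqVneq (Defs.coset_mul E (refl a)) E.
  by rewrite ffunE scaler0.
case: (coset_lt _ _ _); rewrite !ffunE (negPf EC) EaC scaler0 addr0 scaler0 //.
Qed.

End HeckeModule.

(** * The map to the antispherical module *)

Section Antispherical.

Variables (F : numFieldType) (V : vectType F) (Phi : reduced_root_system V).
Variable Pi : {set root_of Phi}.
Hypothesis HPi : simple_roots Pi.
Variable Theta : {set root_of Phi}.
Hypothesis ThetaPi : Theta \subset Pi.

Local Notation W := (subg_of (weyl_group Phi)).
Local Notation len := (length Pi).
Local Notation WT := (parabolic Theta).
Local Notation cls := (coset_cls Theta).
Local Notation elt := (coset_cls (set0 : {set root_of Phi})).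
Local Notation shortest := (shortest Pi).

Implicit Types (a : root_of Phi) (C D E : cosets Theta) (w : W).

Let set0Pi : set0 \subset Pi := sub0set Pi.

Lemma elt_eq (u v : W) : (elt u == elt v) = (u == v).
Proof.
by rewrite cls_eq /parabolic /= imset0 gen0 inE -eq_mulgV1.
Qed.

Lemma shortest_elt w : shortest (elt w) = w.
Proof.
by apply: (shortest_cls HPi set0Pi); apply/min_repP => a; rewrite inE.
Qed.

(** The map zeta, given by its coefficients so that on [phi0] they are the sums of the theorem; its
    values on the basis are found in [antispherical_delta]. *)
Definition antispherical (h : hecke_module (set0 : {set root_of Phi})) :
    hecke_module Theta :=
  [ffun D => \sum_(v in WT) laurent_poly ((- 'X) ^+ len v)
                            * h (elt (v * shortest D)%g)].

Fact antispherical_is_linear : linear antispherical.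
Proof.
move=> k h g; apply/ffunP => D; rewrite !ffunE scaler_sumr -big_split /=.
by apply: eq_bigr => v _; rewrite !ffunE mulrDr /GRing.scale /= mulrCA.
Qed.
HB.instance Definition _ :=
  GRing.isLinear.Build laurent (hecke_module set0) (hecke_module Theta) *:%R
    antispherical antispherical_is_linear.

Lemma antispherical_delta z C : z \in WT ->
  antispherical (delta (elt (z * shortest C)%g)) =
  laurent_poly ((- 'X) ^+ len z) *: delta C.
Proof.
move=> zT; apply/ffunP => D; rewrite !ffunE.
have eqE v : v \in WT -> (elt (z * shortest C)%g == elt (v * shortest D)%g) =
    (C == D) && (z == v).
  move=> vT; rewrite elt_eq; have [->|CD] := eqVneq C D.
    exact: inj_eq (mulIg _) _ _.
  apply: contraNF CD => /eqP/(congr1 cls).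
  by rewrite !cls_mul // !cls_shortest => /eqP.
under eq_bigr => v vT do rewrite deltaE eqE //.
rewrite /GRing.scale /=; have [_|CD] := eqVneq C D; last first.
  by rewrite mulr0 big1 // => v _; rewrite mulr0.
rewrite (bigD1 z) //= eqxx big1 ?addr0 // => v /andP[_ vz].
by rewrite eq_sym (negPf vz) mulr0.
Qed.

(** Write [w = z * y]. If [refl a] fixes the coset, it passes through [y] to a simple reflection
    acting on [z], and both sides vanish. Otherwise it moves [y] to the shortest element of another
    coset and leaves [z] alone. *)
Lemma antispherical_T_delta a w : a \in Pi ->
  antispherical (hecke_T Pi a (delta (elt w))) =
  hecke_T Pi a (antispherical (delta (elt w))).
Proof.
move=> aP; have wwa : Defs.coset_mul (elt w) (refl a) != elt w.
  by rewrite coset_mul_cls elt_eq eq_sym eq_mulVg1 mulKg (refl_neq1 HPi).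
have [z zT wE] := coset_decomp Pi Theta w.
move: wE; set C := cls w; set y := shortest C => wE.
have ym : min_rep Pi Theta y := shortest_min_rep HPi ThetaPi C.
rewrite hecke_T_deltaE /hecke_T_delta (negPf wwa).
rewrite (coset_lt_reflr HPi set0Pi) // coset_mul_cls shortest_elt.
rewrite [in RHS]wE antispherical_delta // linearZ /= hecke_T_deltaE.
have lw : len w = (len z + len y)%N by rewrite {1}wE (length_mul HPi ThetaPi).
have TE k u : antispherical (k *: delta (elt w) + delta (elt u)) =
    k *: (laurent_poly ((- 'X) ^+ len z) *: delta C)
    + antispherical (delta (elt u)).
  by rewrite linearP /= {1}wE antispherical_delta.
rewrite /hecke_T_delta; have [CaC|CaC] := eqVneq (Defs.coset_mul C (refl a)) C.
  have [c cT yaE] := shortest_reflr_fix HPi ThetaPi aP CaC.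
  have zcT : (z * refl c)%g \in WT by rewrite groupM // refl_parabolic.
  have waE : (w * refl a = z * refl c * y)%g.
    by rewrite wE -mulgA -/y yaE mulgA.
  have -> : len (w * refl a)%g = (len (z * refl c)%g + len y)%N.
    by rewrite waE (length_mul HPi ThetaPi).
  have [k [zcE zE]] := length_reflr HPi z (subsetP ThetaPi _ cT).
  rewrite lw ltn_add2r scaler0 waE.
  rewrite !fun_if !TE antispherical_delta // zcE zE.
  (* The coefficient is q (-q)^k + (-q)^(k+1) when [w] goes up and q^-1 (-q)^(k+1) + (-q)^k when it
     goes down; both are zero. *)
  case: pos; rewrite /= ?add0n ?add1n ?ltnSn ?ltnNge ?leqnSn /=;
    rewrite scalerA -scalerDl exprS mulNr rmorphN rmorphM /=.
    by rewrite subrr scale0r.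
  by rewrite mulrN mulrA [laurent_qV * _]mulrC laurent_qVK mul1r addNr scale0r.
have yaE := shortest_reflr HPi ThetaPi aP CaC.
have waE : (w * refl a = z * shortest (Defs.coset_mul C (refl a)))%g.
  by rewrite yaE mulgA -wE.
(* The factor [z] adds the same length on both sides, so the same case of the definition of
   [hecke_T_delta] applies to [w] and to [C]. *)
have -> : (len w < len (w * refl a))%N = (len y < len (y * refl a))%N.
  rewrite lw -yaE waE (length_mul HPi ThetaPi) ?ltn_add2l //.
  exact: shortest_min_rep.
rewrite (coset_lt_reflr HPi ThetaPi) // -/y.
rewrite waE; case: (_ < _)%N;
  rewrite TE antispherical_delta // scalerDr !scalerA.
  by rewrite [laurent_q * _]mulrC.
by rewrite [laurent_qV * _]mulrC.
Qed.

Lemma antispherical_T a h : a \in Pi ->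
  antispherical (hecke_T Pi a h) = hecke_T Pi a (antispherical h).
Proof.
move=> aP; rewrite [in RHS](hecke_module_sum h) !linear_sum /=.
apply: eq_bigr => C _; rewrite !linearZ /= -hecke_T_deltaE; congr (_ *: _).
by rewrite -(cls_shortest Pi C) antispherical_T_delta.
Qed.

End Antispherical.

(** * Comparison of the two Kazhdan-Lusztig families *)

Section Comparison.

Variables (F : numFieldType) (V : vectType F) (Phi : reduced_root_system V).
Variable Pi : {set root_of Phi}.
Hypothesis HPi : simple_roots Pi.
Variable Theta : {set root_of Phi}.
Hypothesis ThetaPi : Theta \subset Pi.

Local Notation W := (subg_of (weyl_group Phi)).
Local Notation len := (length Pi).
Local Notation WT := (parabolic Theta).
Local Notation cls := (coset_cls Theta).
Local Notation elt := (coset_cls (set0 : {set root_of Phi})).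
Local Notation shortest := (shortest Pi).
Local Notation zeta := (antispherical Pi Theta).

Implicit Types (a : root_of Phi) (C D E : cosets Theta) (w : W).

Let set0Pi : set0 \subset Pi := sub0set Pi.

Variable P : cosets Theta -> cosets Theta -> {poly int}.
Hypothesis HP : whittaker_kl Pi P.
Variable P0 : cosets (set0 : {set root_of Phi}) ->
              cosets (set0 : {set root_of Phi}) -> {poly int}.
Hypothesis HP0 : whittaker_kl Pi P0.

Local Notation phi := (whittaker_phi Pi P).
Local Notation phi0 := (whittaker_phi Pi P0).

(** The expected value of [zeta (phi0 (elt w))]. *)
Definition phi_min_rep w : hecke_module Theta :=
  if min_rep Pi Theta w then phi (cls w) else 0.

Lemma min_rep_shortest w : min_rep Pi Theta w = (w == shortest (cls w)).
Proof.
apply/idP/eqP => [wm|->]; first by rewrite (shortest_cls HPi ThetaPi wm).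
exact: (shortest_min_rep HPi ThetaPi).
Qed.

Lemma min_rep_mul z C : z \in WT ->
  min_rep Pi Theta (z * shortest C)%g = (z == 1%g).
Proof.
move=> zT; rewrite min_rep_shortest cls_mul // cls_shortest.
by rewrite -{2}[shortest C]mul1g (inj_eq (mulIg _)).
Qed.

(** The expected values obey the same recursion as the images of [phi0], up to an integral
    combination of the [phi D]. That combination is zero except when [w] is a minimal
    representative, where it comes from [wkl_step]. *)
Lemma phi_min_rep_step w : w != 1%g ->
  exists2 a, a \in Pi & (len (w * refl a)%g < len w)%N /\
  exists n : cosets Theta -> int,
    hecke_T Pi a (phi_min_rep (w * refl a)%g) =
    phi_min_rep w + \sum_D (n D)%:~R *: phi D.
Proof.
have ext0 (x : hecke_module Theta) :
    x = x + \sum_D (0 : int)%:~R *: phi D.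
  by rewrite big1 ?addr0 // => D _; rewrite scale0r.
have [z zT ->] := coset_decomp Pi Theta w; move: (cls w) => C w1 {w}.
have [y1|y1] := eqVneq (shortest C) 1%g.
  rewrite y1 mulg1 in w1 *; have [a aP lt] := descent_ex HPi w1.
  (* For [a] outside [Theta], [z^-1] preserves the coordinate 1 of [a] at itself, so the image of
     [a] stays positive and [refl a] would lengthen [z]. *)
  have aT : a \in Theta.
    apply: contraLR lt => aT; have [k [-> ->]] := length_reflr HPi z aP.
    suff -> : pos Pi (wact z^-1%g a) by rewrite add0n add1n ltnNge leqnSn.
    apply/contraT => /(nposP HPi)/(_ a aP).
    rewrite (cf_parabolic HPi ThetaPi) ?groupV // (cf_simple HPi) // eqxx.
    by rewrite ler10.
  have zaT : (z * refl a)%g \in WT by rewrite groupM // refl_parabolic.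
  have cls1 x : x \in WT -> cls x = cls 1%g.
    by move=> xT; rewrite -[x]mulg1 cls_mul.
  have minE x : x \in WT -> min_rep Pi Theta x = (x == 1%g).
    have C1 : C = cls 1%g by rewrite -y1 cls_shortest.
    by move=> xT; rewrite -(min_rep_mul C xT) y1 mulg1.
  exists a => //; split=> //; exists (fun=> 0); rewrite -ext0 /phi_min_rep.
  (* If [z * refl a = 1], the operator is applied to the basis element of the coset of 1, which
     [refl a] fixes since [a] is in [Theta]; the result is 0. *)
  rewrite !minE // (negPf w1); case: eqP => [za|_]; last by rewrite linear0.
  rewrite cls1 // (whittaker_phi1 HPi ThetaPi) hecke_T_deltaE /hecke_T_delta.
  by rewrite coset_mul_cls mul1g cls1 ?refl_parabolic // eqxx.
have [a aP lt] := descent_ex HPi y1; exists a => //.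
have ym := shortest_min_rep HPi ThetaPi C.
(* If [C] were fixed, [shortest C * refl a] would equal [refl c * shortest C], which is no shorter
   than [shortest C]. *)
have CaC : Defs.coset_mul C (refl a) != C.
  apply/eqP => /(shortest_reflr_fix HPi ThetaPi aP)[c cT yaE].
  move: lt; rewrite yaE (length_mul HPi ThetaPi) ?refl_parabolic //.
  by rewrite ltnNge leq_addl.
have yaE := shortest_reflr HPi ThetaPi aP CaC.
have yam := shortest_min_rep HPi ThetaPi (Defs.coset_mul C (refl a)).
split.
  by rewrite -mulgA -yaE !(length_mul HPi ThetaPi) // ltn_add2l yaE.
rewrite /phi_min_rep -mulgA -yaE !min_rep_mul // !cls_mul // !cls_shortest.
have [_|_] := eqVneq z 1%g; last by exists (fun=> 0); rewrite linear0 -ext0.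
have [c ->] := wkl_step HPi ThetaPi HP aP lt CaC.
exists (fun D => if coset_lt Pi D C then c D else 0).
congr (_ + _); rewrite big_mkcond; apply: eq_bigr => D _.
by case: ifP => // _; rewrite scale0r.
Qed.

Lemma antispherical_phi0E w D : zeta (phi0 (elt w)) D =
  laurent_poly (\sum_(v in WT) (- 'X) ^+ len v *
                P0 (elt w) (elt (v * shortest D)%g)) :> laurent.
Proof.
rewrite ffunE rmorph_sum; apply: eq_bigr => v _.
by rewrite rmorphM /= (whittaker_phiE HP0).
Qed.

(** At q = 0 only [v = 1] contributes, every other [v] having positive length. *)
Lemma antispherical_phi0_horner0 w D :
  (\sum_(v in WT) (- 'X) ^+ len v *
     P0 (elt w) (elt (v * shortest D)%g)).[0] = (w == shortest D)%:R.
Proof.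
rewrite horner_sum (bigD1 1%g) ?group1 //= big1 => [|v /andP[_ v1]].
  by rewrite (length1 HPi) expr0 mul1r (wkl_horner0 HP0) elt_eq mul1g addr0.
rewrite hornerM horner_exp hornerN hornerX oppr0 expr0n.
have /negPf -> : len v != 0%N by apply: contra v1 => /eqP/(length_eq0 HPi) ->.
by rewrite mul0r.
Qed.

Lemma antispherical_phi0 w : zeta (phi0 (elt w)) = phi_min_rep w.
Proof.
move: {2}(len w).+1 (ltnSn (len w)) => m; elim: m w => // m IHm w.
rewrite ltnS => wm; have [->|w1] := eqVneq w 1%g.
  have m1 : min_rep Pi Theta 1%g.
    apply/min_repP => a aT; rewrite wact1; apply: (pos_simple HPi).
    exact: (subsetP ThetaPi).
  rewrite (whittaker_phi1 HPi set0Pi) /phi_min_rep m1.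
  rewrite (whittaker_phi1 HPi ThetaPi).
  have := antispherical_delta Pi (cls 1%g) (group1 WT).
  rewrite (shortest_cls HPi ThetaPi m1) mulg1 => ->.
  by rewrite (length1 HPi) expr0 laurent_poly1 scale1r.
have [a aP [lt [n nE]]] := phi_min_rep_step w1.
have eaw : Defs.coset_mul (elt w) (refl a) != elt w.
  by rewrite coset_mul_cls elt_eq eq_sym eq_mulVg1 mulKg (refl_neq1 HPi).
have [|c] := wkl_step HPi set0Pi HP0 aP _ eaw; first by rewrite shortest_elt.
rewrite coset_mul_cls => /(congr1 zeta).
rewrite (antispherical_T HPi ThetaPi) // IHm; last exact: leq_trans lt wm.
rewrite nE linearD linear_sum /= => eq1.
(* By induction each lower [phi0 D0] is sent to some [phi D] or to 0; [N D] collects the [c D0] of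
   those sent to [phi D]. *)
have [N eq2] : exists N : cosets Theta -> int,
    \sum_(D0 | coset_lt Pi D0 (elt w)) zeta ((c D0)%:~R *: phi0 D0) =
    \sum_D (N D)%:~R *: phi D.
  exists (fun D => \sum_(D0 | coset_lt Pi D0 (elt w))
    if min_rep Pi Theta (shortest D0) && (cls (shortest D0) == D)
    then c D0 else 0).
  under [RHS]eq_bigr => D _ do rewrite rmorph_sum scaler_suml.
  rewrite exchange_big; apply: eq_bigr => D0 ltD0 /=.
  have zphi : zeta (phi0 D0) = phi_min_rep (shortest D0).
    rewrite -{1}(cls_shortest Pi D0) IHm //.
    apply: leq_trans wm; have := coset_lt_length HPi set0Pi ltD0.
    by rewrite (shortest_elt HPi).
  transitivity ((c D0)%:~R *: zeta (phi0 D0)); first exact: linearZ.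
  rewrite zphi /phi_min_rep; case: ifP => _ /=; last first.
    by rewrite scaler0 big1 // => D _; rewrite scale0r.
  rewrite (bigD1 (cls (shortest D0))) //= eqxx big1 ?addr0 // => D.
  by rewrite eq_sym => /negPf ->; rewrite scale0r.
rewrite {}eq2 in eq1.
have eq3 : \sum_D (n D - N D)%:~R *: phi D
           = zeta (phi0 (elt w)) - phi_min_rep w.
  under eq_bigr => D _ do rewrite rmorphB scalerBl.
  rewrite sumrB; apply/eqP; rewrite subr_eq addrAC eq_sym subr_eq.
  by rewrite -eq1 addrC.
apply/eqP; rewrite -subr_eq0 -eq3; apply/eqP; apply: big1 => D _.
(* The polynomial supplied for [E] is the coefficient at [E] of the difference. *)
rewrite (phi_comb_eq0 HP (n := fun D => n D - N D) (p := fun E =>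
  \sum_(v in WT) (- 'X) ^+ len v * P0 (elt w) (elt (v * shortest E)%g)
  - if min_rep Pi Theta w then P (cls w) E else 0)) ?scale0r // => E.
  have subE (x y : hecke_module Theta) : (x - y) E = x E - y E.
    by rewrite !ffunE.
  rewrite eq3 subE antispherical_phi0E rmorphB; congr (_ - _).
  rewrite /phi_min_rep.
  case: ifP => _; first exact: (whittaker_phiE HP).
  by rewrite ffunE; exact/esym/laurent_poly0.
(* Both constant terms are 1 when [w = shortest E] and 0 otherwise. *)
rewrite hornerD hornerN antispherical_phi0_horner0 min_rep_shortest.
have [wE|wE] := eqVneq w (shortest (cls w)).
  rewrite (wkl_horner0 HP) {1}wE.
  have -> : (shortest (cls w) == shortest E) = (cls w == E).
    by apply/eqP/eqP => [/(congr1 cls)|->//]; rewrite !cls_shortest.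
  exact: subrr.
rewrite horner0 subr0; have [wE'|//] := eqVneq w (shortest E).
by case/eqP: wE; rewrite wE' cls_shortest.
Qed.

End Comparison.

Theorem proposition6p6 (F : numFieldType) (V : vectType F)
    (Phi : reduced_root_system V) (Pi : {set root_of Phi})
    (HPi : simple_roots Pi)
    (Theta : {set root_of Phi}) (HTheta : Theta \subset Pi)
    (P : cosets Theta -> cosets Theta -> {poly int})
    (HP : whittaker_kl Pi P)
    (P0 : cosets (set0 : {set root_of Phi}) ->
          cosets (set0 : {set root_of Phi}) -> {poly int})
    (HP0 : whittaker_kl Pi P0)
    (C D : cosets Theta) :
  let wTheta := longest Pi (parabolic Theta) in
  P C D =
  \sum_(v in parabolic Theta)
    (- 'X) ^+ length Pi v *
    P0 (coset_cls set0 (wTheta * longest Pi (val C))%g)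
       (coset_cls set0 (v * wTheta * longest Pi (val D))%g).
Proof.
move=> wTheta; apply: laurent_poly_inj.
(* As [wTheta] is an involution, it cancels against the same factor of the longest element, and the
   sum becomes a coefficient of [antispherical]. *)
have wK (E : cosets Theta) : (wTheta * longest Pi (val E))%g = shortest Pi E.
  rewrite (longest_coset HPi HTheta) mulgA.
  by rewrite (longest_parabolic_sqr HPi HTheta) mul1g.
under eq_bigr => v _ do rewrite -mulgA !wK.
rewrite -(antispherical_phi0E HP0) (antispherical_phi0 HPi HTheta HP HP0).
rewrite /phi_min_rep (shortest_min_rep HPi HTheta) cls_shortest.
by rewrite (whittaker_phiE HP).
Qed.
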